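(* Let $\Bbbk$ be a field, let $G$ be a nontrivial finite group with $\operatorname{char}\Bbbk\nmid|G|$, and let $R$ be a left $G$-module algebra over $\Bbbk$. Let $B=R*G$ be the skew group algebra, with $R$ and $\Bbbk G$ viewed as subalgebras of $B$, and let $e=\frac1{|G|}\sum_{g\in G}g\in\Bbbk G\subseteq B$. Let $\mathcal M_R$ be the class of right $R$-modules obtained (by restriction to $R$) from right $B$-modules $M$ that are annihilated by $e$, i.e. $Me=0$. Then $$\mathfrak r(R,G)=\bigcap_{M\in\mathcal M_R}\operatorname{Ann}_R(M),$$ where $\operatorname{Ann}_R(M)$ is the annihilator of $M$ in $R$ and $\mathfrak r(R,G)$ is the $G$-radical of $R$.
   Context: A left $G$-module algebra $R$ is a $\Bbbk$-algebra on which $G$ acts by $\Bbbk$-algebra automorphisms. The skew group algebra $R*G$ is $R\otimes\Bbbk G$ with $(r\otimes g)(s\otimes h)=r(g\cdot s)\otimes gh$. Two sequences $(a_1,\dots,a_n)$, $(b_1,\dots,b_n)$ of elements of $R$ are pertinent under the $G$-action if $\sum_{i=1}^n a_i(g\cdot b_i)=0$ for all $1\ne g\in G$. The $G$-radical of $R$ is the two-sided ideal $\mathfrak r(R,G)=\{\sum_{i=1}^n a_ib_i: n\ge1,\ (a_1,\dots,a_n),(b_1,\dots,b_n)\text{ pertinent under the }G\text{-action}\}$. *)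

(* Defs.v *)
From HB Require Import structures.
From mathcomp Require Import all_boot all_order all_algebra all_fingroup.
From mathcomp Require Import classical_sets.
Set Implicit Arguments.
Unset Strict Implicit.
Unset Printing Implicit Defensive.
Import GRing.Theory.
Local Open Scope ring_scope.

(* A left G-module algebra is an algebra R together with an action of this
   type, where G is all of gT.  MathComp's {action _ &-> _} are right actions.
   Each gact g is bijective because of the two laws. *)
Record galgAction (k : fieldType) (gT : finGroupType) (R : algType k) :=
  GalgAction {
    gact :> gT -> {lrmorphism R -> R};
    gact1 : forall r, gact 1%g r = r;
    gactM : forall g h r, gact (g * h)%g r = gact g (gact h r)
  }.

(* The skew group algebra R * G. An element x : gT -> R stands for
   \sum_g (x g) (x) g in R (x) k[G]. *)
Definition skew_alg (k : fieldType) (gT : finGroupType) (R : algType k)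
  (alpha : galgAction gT R) : Type := {ffun gT -> R}.

Section SkewGroupAlgebra.
Variables (k : fieldType) (gT : finGroupType) (R : algType k).
Variable alpha : galgAction gT R.
Local Notation B := (skew_alg alpha).

HB.instance Definition _ := GRing.Lmodule.copy B {ffun gT -> R}.

(* The pure tensor r (x) g. *)
Definition stensor (r : R) (g : gT) : B := [ffun h => if h == g then r else 0].

Definition skew_mul (x y : B) : B :=
  \sum_g \sum_h stensor (x g * alpha g (y h)) (g * h)%g.

Definition skew_one : B := stensor 1 1%g.

Lemma stensorE r g h : stensor r g h = if h == g then r else 0.
Proof. by rewrite ffunE. Qed.

Lemma stensor0 g : stensor 0 g = 0.
Proof. by apply/ffunP=> h; rewrite !ffunE if_same. Qed.

Lemma stensorD r s g : stensor (r + s) g = stensor r g + stensor s g.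
Proof. by apply/ffunP=> h; rewrite !ffunE; case: ifP; rewrite ?addr0. Qed.

Lemma stensorZ (a : k) r g : stensor (a *: r) g = a *: stensor r g.
Proof. by apply/ffunP=> h; rewrite !ffunE; case: ifP; rewrite ?scaler0. Qed.

Lemma skew_sum_stensor (x : B) : x = \sum_g stensor (x g) g.
Proof.
apply/ffunP=> h; rewrite sum_ffunE (bigD1 h) //= stensorE eqxx big1 ?addr0 //.
by move=> g /negbTE ngh; rewrite stensorE eq_sym ngh.
Qed.

Lemma skew_mulDl : left_distributive skew_mul +%R.
Proof.
move=> x y z; rewrite /skew_mul -big_split; apply: eq_bigr => g _ /=.
rewrite -big_split; apply: eq_bigr => h _ /=.
by rewrite ffunE mulrDl stensorD.
Qed.

Lemma skew_mulDr : right_distributive skew_mul +%R.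
Proof.
move=> x y z; rewrite /skew_mul -big_split; apply: eq_bigr => g _ /=.
rewrite -big_split; apply: eq_bigr => h _ /=.
by rewrite ffunE raddfD mulrDr stensorD.
Qed.

Lemma skew_mul0 x : skew_mul x 0 = 0.
Proof.
by rewrite /skew_mul big1 // => g _; rewrite big1 // => h _;
  rewrite ffunE raddf0 mulr0 stensor0.
Qed.

Lemma skew_0mul x : skew_mul 0 x = 0.
Proof.
by rewrite /skew_mul big1 // => g _; rewrite big1 // => h _;
  rewrite ffunE mul0r stensor0.
Qed.

Lemma skew_mul_stensor r g s h :
  skew_mul (stensor r g) (stensor s h) = stensor (r * alpha g s) (g * h)%g.
Proof.
rewrite /skew_mul (bigD1 g) //= [X in _ + X]big1 ?addr0; last first.
  move=> g' /negbTE ng; rewrite big1 // => h' _.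
  by rewrite stensorE ng mul0r stensor0.
rewrite (bigD1 h) //= [X in _ + X]big1 ?addr0; last first.
  by move=> h' /negbTE nh; rewrite !stensorE nh raddf0 mulr0 stensor0.
by rewrite !stensorE !eqxx.
Qed.

Lemma skew_mul_suml (I : finType) (F : I -> B) y :
  skew_mul (\sum_i F i) y = \sum_i skew_mul (F i) y.
Proof.
by apply: (big_morph (skew_mul^~ y)) => [u v|];
  [exact: skew_mulDl | exact: skew_0mul].
Qed.

Lemma skew_mul_sumr (I : finType) (F : I -> B) y :
  skew_mul y (\sum_i F i) = \sum_i skew_mul y (F i).
Proof.
by apply: (big_morph (skew_mul y)) => [u v|];
  [exact: skew_mulDr | exact: skew_mul0].
Qed.

Lemma skew_mulA : associative skew_mul.
Proof.
move=> x y z; rewrite (skew_sum_stensor x) !skew_mul_suml.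
apply: eq_bigr => g _; rewrite (skew_sum_stensor y).
rewrite [in LHS]skew_mul_suml !skew_mul_sumr skew_mul_suml.
apply: eq_bigr => h _; rewrite (skew_sum_stensor z) !skew_mul_sumr.
apply: eq_bigr => l _.
by rewrite !skew_mul_stensor gactM rmorphM mulrA mulgA.
Qed.

Lemma skew_mul1 : right_id skew_one skew_mul.
Proof.
move=> x; rewrite [in LHS](skew_sum_stensor x) skew_mul_suml.
rewrite [RHS]skew_sum_stensor; apply: eq_bigr => g _.
by rewrite skew_mul_stensor rmorph1 mulr1 mulg1.
Qed.

Lemma skew_1mul : left_id skew_one skew_mul.
Proof.
move=> x; rewrite [in LHS](skew_sum_stensor x) skew_mul_sumr.
rewrite [RHS]skew_sum_stensor; apply: eq_bigr => g _.
by rewrite skew_mul_stensor gact1 mul1r mul1g.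
Qed.

Lemma skew_one_neq0 : skew_one != 0.
Proof.
apply/eqP=> /ffunP/(_ 1%g); rewrite !ffunE eqxx.
by move/eqP; rewrite oner_eq0.
Qed.

HB.instance Definition _ := GRing.Zmodule_isNzRing.Build B
  skew_mulA skew_1mul skew_mul1 skew_mulDl skew_mulDr skew_one_neq0.

Lemma skew_scaleAl (a : k) (x y : B) : a *: (x * y) = (a *: x) * y.
Proof.
rewrite /GRing.mul /= /skew_mul scaler_sumr; apply: eq_bigr => g _.
rewrite scaler_sumr; apply: eq_bigr => h _.
by rewrite ffunE -scalerAl stensorZ.
Qed.

HB.instance Definition _ := GRing.Lmodule_isLalgebra.Build k B skew_scaleAl.

Lemma skew_scaleAr (a : k) (x y : B) : a *: (x * y) = x * (a *: y).
Proof.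
rewrite /GRing.mul /= /skew_mul scaler_sumr; apply: eq_bigr => g _.
rewrite scaler_sumr; apply: eq_bigr => h _.
by rewrite ffunE linearZ /= -scalerAr stensorZ.
Qed.

HB.instance Definition _ := GRing.Lalgebra_isAlgebra.Build k B skew_scaleAr.

Lemma stensorM r g s h :
  stensor r g * stensor s h = stensor (r * alpha g s) (g * h)%g.
Proof. exact: skew_mul_stensor. Qed.

(* The copies of R and of the basis G of k[G] inside R * G. *)
Definition skew_inR (r : R) : B := stensor r 1%g.

Lemma skew_inR_is_zmod_morphism : zmod_morphism skew_inR.
Proof.
by move=> r s; apply/ffunP=> h; rewrite !ffunE; case: ifP; rewrite ?subr0.
Qed.

Lemma skew_inR_is_monoid_morphism : monoid_morphism skew_inR.
Proof. by split=> // r s; rewrite /skew_inR stensorM gact1 mulg1. Qed.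

Lemma skew_inR_is_scalable : scalable skew_inR.
Proof. by move=> a r; exact: stensorZ. Qed.

HB.instance Definition _ :=
  GRing.isZmodMorphism.Build R B skew_inR skew_inR_is_zmod_morphism.
HB.instance Definition _ :=
  GRing.isMonoidMorphism.Build R B skew_inR skew_inR_is_monoid_morphism.
HB.instance Definition _ :=
  GRing.isScalable.Build k R B *:%R skew_inR skew_inR_is_scalable.

Definition skew_inG (g : gT) : B := stensor 1 g.

Definition skew_e : B := (#|gT|%:R : k)^-1 *: \sum_g skew_inG g.

Definition pertinent (n : nat) (a b : 'I_n -> R) : Prop :=
  forall g : gT, g != 1%g -> \sum_(i < n) a i * alpha g (b i) = 0.

Definition gradical : set R :=
  [set r | exists n : nat, exists a b : 'I_n -> R,
     [/\ (0 < n)%N, pertinent a b & r = \sum_(i < n) a i * b i]].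

End SkewGroupAlgebra.

(* Right A-modules are left modules over the converse ring A^c. *)
Notation rmodType A := (lmodType A^c).

Definition rscale (A : pzRingType) (M : rmodType A) (m : M) (a : A) : M :=
  (a : A^c) *: m.

Definition rann (A : pzRingType) (M : rmodType A) : set A :=
  [set a | forall m : M, rscale m a = 0].

Section Restriction.
Variables A C : pzRingType.

(* Restriction of scalars of a right C-module along f : A -> C. *)
Definition rrestrict_sort (f : {rmorphism A -> C}) (M : rmodType C) : Type := M.

Variables (f : {rmorphism A -> C}) (M : rmodType C).

HB.instance Definition _ := GRing.Zmodule.copy (rrestrict_sort f M) M.

Definition rrestrict_scale (a : A^c) (m : rrestrict_sort f M) :
  rrestrict_sort f M := rscale (m : M) (f a).

Lemma rrestrict_scaleA a b m :
  rrestrict_scale a (rrestrict_scale b m) = rrestrict_scale (a * b) m.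
Proof.
rewrite /rrestrict_scale /rscale scalerA; congr (_ *: _).
exact: esym (rmorphM f (b : A) (a : A)).
Qed.

Lemma rrestrict_scale1 : left_id 1 rrestrict_scale.
Proof.
move=> m; rewrite /rrestrict_scale /rscale.
by rewrite (rmorph1 f : f (1 : A^c) = (1 : C^c)) scale1r.
Qed.

Lemma rrestrict_scaleDr : right_distributive rrestrict_scale +%R.
Proof. by move=> a m n; exact: scalerDr. Qed.

Lemma rrestrict_scaleDl m : {morph rrestrict_scale^~ m : a b / a + b}.
Proof.
move=> a b; rewrite /rrestrict_scale /rscale.
rewrite (rmorphD f (a : A) (b : A) : f (a + b : A^c) = _).
exact: scalerDl.
Qed.

HB.instance Definition _ := GRing.Zmodule_isLmodule.Build A^c
  (rrestrict_sort f M) rrestrict_scaleA rrestrict_scale1 rrestrict_scaleDr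
  rrestrict_scaleDl.

Definition rrestrict : rmodType A := rrestrict_sort f M.

Lemma rscale_rrestrict (m : rrestrict) (a : A) : 
  rscale m a = rscale (m : M) (f a).
Proof. by []. Qed.

End Restriction.

(* A class of modules is a predicate, since lmodType is too large to be the
   carrier of a classical set. *)
Definition rmod_killed_by_e (k : fieldType) (gT : finGroupType) (R : algType k)
    (alpha : galgAction gT R) (N : rmodType R) : Prop :=
  exists2 M : rmodType (skew_alg alpha),
    forall m : M, rscale m (skew_e alpha) = 0 &
    N = rrestrict (@skew_inR k gT R alpha) M.

Definition bigcap_rann (A : pzRingType) (P : rmodType A -> Prop) : set A :=
  [set a | forall N : rmodType A, P N -> rann N a].

(* Main.v *)
Require Import Defs.
From HB Require Import structures.
From mathcomp Require Import all_boot all_order all_algebra all_fingroup.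
From mathcomp Require Import boolp classical_sets.
Set Implicit Arguments.
Unset Strict Implicit.
Unset Printing Implicit Defensive.
Import GRing.Theory.
Local Open Scope ring_scope.
Local Open Scope classical_set_scope.

(* With e' = |G| e, an element of B e B has the form
   \sum_i a_i e' b_i = \sum_g (\sum_i a_i (g b_i)) (x) g, because e absorbs G.
   Such an element lies in R exactly when the sequences (a_i) and (b_i) are
   pertinent, and then it equals \sum_i a_i b_i; so r(R,G) is the intersection
   of R with B e B.  A module with M e = 0 is killed by B e B, and
   conversely B / B e B is such a module, on which an element of R acting
   as zero must lie in B e B. *)

Section QuotientModule.
Local Open Scope quotient_scope.
Variables (K : pzRingType) (V : lmodType K) (I : submodClosed V).

(* The library does not make a submodClosed predicate a zmodClosed one. *)
Definition submod_pred (x : V) : bool := x \in I.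

HB.instance Definition _ := GRing.isZmodClosed.Build V submod_pred
  (GRing.submod_closedB (submodClosedP I)).

Local Notation quot :=
  (Quotient.quot (GRing.ZmodClosed.clone V submod_pred _)).

Definition quotmod : Type := quot.

HB.instance Definition _ := GRing.Zmodule.copy quotmod quot.

Definition quotmod_pi (x : V) : quotmod := \pi_quot x.

Lemma quotmod_pi_eq x y : quotmod_pi x = quotmod_pi y <-> x - y \in I.
Proof.
change (x - y \in I) with (x - y \in submod_pred).
by rewrite Quotient.idealrBE; split=> [|/eqP //]; move/eqP.
Qed.

Lemma quotmod_piD x y : quotmod_pi (x + y) = quotmod_pi x + quotmod_pi y.
Proof. exact: pi_addr. Qed.

Lemma quotmod_pi_eq0 x : quotmod_pi x = 0 <-> x \in I.
Proof.
have -> : 0 = quotmod_pi 0 by apply: esym; exact: pi_zeror.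
by rewrite quotmod_pi_eq subr0.
Qed.

Lemma quotmod_ind (P : quotmod -> Prop) :
  (forall x, P (quotmod_pi x)) -> forall m, P m.
Proof. by move=> H m; rewrite -[m]reprK; apply: H. Qed.

Definition quotmod_scale (a : K) (m : quotmod) : quotmod :=
  quotmod_pi (a *: generic_quotient.repr (m : quot)).

(** The chosen representative of the class of [x] differs from [x] by an element of [I], and [I] is
    closed under scaling, so the choice does not matter. *)
Lemma quotmod_scale_pi a x :
  quotmod_scale a (quotmod_pi x) = quotmod_pi (a *: x).
Proof.
apply/quotmod_pi_eq; rewrite -scalerBr rpredZ //.
by apply/quotmod_pi_eq; rewrite /quotmod_pi reprK.
Qed.

Lemma quotmod_scaleA a b m :
  quotmod_scale a (quotmod_scale b m) = quotmod_scale (a * b) m.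
Proof. by elim/quotmod_ind: m => x; rewrite !quotmod_scale_pi scalerA. Qed.

Lemma quotmod_scale1 : left_id 1 quotmod_scale.
Proof. by elim/quotmod_ind=> x; rewrite quotmod_scale_pi scale1r. Qed.

Lemma quotmod_scaleDr : right_distributive quotmod_scale +%R.
Proof.
move=> a m n; elim/quotmod_ind: m => x; elim/quotmod_ind: n => y.
by rewrite -quotmod_piD !quotmod_scale_pi scalerDr quotmod_piD.
Qed.

Lemma quotmod_scaleDl m : {morph quotmod_scale^~ m : a b / a + b}.
Proof.
move=> a b; elim/quotmod_ind: m => x.
by rewrite !quotmod_scale_pi scalerDl quotmod_piD.
Qed.

HB.instance Definition _ := GRing.Zmodule_isLmodule.Build K quotmod
  quotmod_scaleA quotmod_scale1 quotmod_scaleDr quotmod_scaleDl.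

Lemma quotmod_piZ a x : quotmod_pi (a *: x) = a *: quotmod_pi x.
Proof. by rewrite -quotmod_scale_pi. Qed.

End QuotientModule.

Section IdealOfE.
Variables (k : fieldType) (gT : finGroupType) (R : algType k).
Variable alpha : galgAction gT R.
Local Notation B := (skew_alg alpha).

(* The |G|-fold of \sum_i a_i e b_i, where s lists the pairs (a_i, b_i). *)
Definition tw_sum (s : seq (R * R)) : B :=
  [ffun g => \sum_(p <- s) p.1 * alpha g p.2].

Lemma tw_sumE s g : tw_sum s g = \sum_(p <- s) p.1 * alpha g p.2.
Proof. by rewrite ffunE. Qed.

Lemma skew_mulE (x y : B) g :
  (x * y) g = \sum_h x h * alpha h (y (h^-1 * g)%g).
Proof.
rewrite /GRing.mul /= /skew_mul sum_ffunE; apply: eq_bigr => h _.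
rewrite sum_ffunE (bigD1 (h^-1 * g)%g) //= stensorE mulKVg eqxx.
rewrite big1 ?addr0 // => l nl; rewrite stensorE; case: eqP => // Eg.
by case/eqP: nl; rewrite Eg mulKg.
Qed.

Lemma skew_eE g : skew_e alpha g = (#|gT|%:R : k)^-1 *: 1.
Proof.
rewrite ffunE; congr (_ *: _).
rewrite sum_ffunE (bigD1 g) //= stensorE eqxx big1 ?addr0 //.
by move=> h /negbTE nh; rewrite stensorE eq_sym nh.
Qed.

(** The factor |G| put on b_i cancels the 1/|G| in e; what remains is the sum over g of a_i g b_i =
    a_i (g.b_i) (x) g. *)
Lemma tw_sum_expand s : (#|gT|%:R : k) != 0 ->
  tw_sum s = \sum_(p <- s) skew_inR alpha p.1 * skew_e alpha *
                           skew_inR alpha ((#|gT|%:R : k) *: p.2).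
Proof.
move=> ntk; apply/ffunP=> g; rewrite ffunE sum_ffunE.
apply: eq_bigr => p _; rewrite /skew_e -scalerAr -scalerAl linearZ /=.
rewrite -scalerAr scalerA mulVf // scale1r mulr_sumr mulr_suml sum_ffunE.
have tens h : skew_inR alpha p.1 * skew_inG alpha h * skew_inR alpha p.2 =
              stensor alpha (p.1 * alpha h p.2) h.
  by rewrite !stensorM rmorph1 mulr1 mulg1 mul1g.
rewrite (bigD1 g) //= tens stensorE eqxx big1 ?addr0 // => h /negbTE nh.
by rewrite tens stensorE eq_sym nh.
Qed.

Lemma tw_sumD s t : tw_sum s + tw_sum t = tw_sum (s ++ t).
Proof. by apply/ffunP=> g; rewrite !ffunE big_cat. Qed.

(** Since r h = h (h^-1.r) in B and e h = e, one gets e b (y_h h) = e (h^-1.(b y_h)). The new second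
    entries add these up, with h replaced by h^-1. *)
Lemma tw_sumM s (y : B) :
  tw_sum s * y =
  tw_sum [seq (p.1, \sum_h alpha h (p.2 * y h^-1%g)) | p <- s].
Proof.
apply/ffunP=> g; rewrite skew_mulE ffunE big_map /=.
(* Replacing h by g h turns the argument h^-1 g of [y] into h^-1, and [alpha g] then factors out of
   the sum. *)
rewrite (reindex (mulg g)) /=; last first.
  by exists (mulg g^-1) => h _; rewrite ?mulKg ?mulKVg.
under eq_bigr => h _ do rewrite ffunE mulr_suml.
rewrite exchange_big; apply: eq_bigr => p _ /=.
rewrite raddf_sum mulr_sumr; apply: eq_bigr => h _.
by rewrite -mulrA -rmorphM invMg mulgKV /= Defs.gactM.
Qed.

(** As h e = e, the product x e depends only on the sum of the coefficients of [x]; the scalar 1/|G|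
    makes up for [tw_sum] using |G| e. *)
Lemma mul_skew_e (x : B) :
  x * skew_e alpha = tw_sum [:: ((#|gT|%:R : k)^-1 *: \sum_h x h, 1)].
Proof.
apply/ffunP=> g; rewrite skew_mulE ffunE big_seq1 /= rmorph1 mulr1 scaler_sumr.
by apply: eq_bigr => h _; rewrite skew_eE linearZ rmorph1 -scalerAr mulr1.
Qed.

(* B e B, as a submodule of the right regular B-module (B^c)^o. *)
Definition e_ideal (x : (B^c)^o) : bool := `[< exists s, x = tw_sum s >].

Lemma e_ideal_submod : GRing.submod_closed e_ideal.
Proof.
split=> [|y _ _ /asboolP[s ->] /asboolP[t ->]]; apply/asboolP.
  by exists [::]; apply/ffunP=> g; rewrite !ffunE big_nil.
by rewrite [y *: _](tw_sumM s (y : B)) tw_sumD; eexists.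
Qed.

HB.instance Definition _ := GRing.isSubmodClosed.Build B^c (B^c)^o e_ideal
  (GRing.submod_closed_semi e_ideal_submod).

Definition skew_mod_e : rmodType B :=
  quotmod (GRing.SubmodClosed.clone _ _ e_ideal _).

Lemma skew_mod_e_killed (m : skew_mod_e) : rscale m (skew_e alpha) = 0.
Proof.
elim/quotmod_ind: m => x; rewrite /rscale -quotmod_piZ.
apply/quotmod_pi_eq0/asboolP; rewrite [_ *: x](mul_skew_e (x : B)).
by eexists.
Qed.

Lemma skew_mod_e_ann (x : B) : rann skew_mod_e x -> exists s, x = tw_sum s.
Proof.
(* The class of 1 suffices as a test vector: [x] sends it to the class of [x]. *)
move/(_ (quotmod_pi _ 1)); rewrite /rscale -quotmod_piZ.
by move/quotmod_pi_eq0/asboolP; rewrite [_ *: 1](mul1r x).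
Qed.

(** For each term, m (a e b) = ((m a) e) b, and m a is again an element of [M], hence killed by
    e. *)
Lemma tw_sum_kills (M : rmodType B) s : (#|gT|%:R : k) != 0 ->
  (forall m : M, rscale m (skew_e alpha) = 0) -> rann M (tw_sum s).
Proof.
move=> ntk Me m; rewrite tw_sum_expand // /rscale.
have scM (x y : B) : ((x * y : B) : B^c) *: m = (y : B^c) *: ((x : B^c) *: m).
  by rewrite scalerA.
elim/big_rec: _ => [|p y _ IH]; first exact: scale0r.
rewrite [LHS](scalerDl m (_ : B^c)) IH addr0 !scM.
have := Me ((skew_inR alpha p.1 : B^c) *: m).
by rewrite /rscale => ->; rewrite scaler0.
Qed.

(** Compare coefficients in B: at g = 1 they express r as the sum of the a_i b_i, and at each other
    g they give the pertinence relation. *)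
Lemma gradicalP r : gradical alpha r <-> exists s, skew_inR alpha r = tw_sum s.
Proof.
split=> [[n [a [b [_ ab0 ->]]]]|[s Es]].
  exists [seq (a i, b i) | i <- enum 'I_n]; apply/ffunP=> g.
  rewrite tw_sumE stensorE big_map big_enum /=; case: eqP => [->|/eqP ng].
    by apply: eq_bigr => i _; rewrite Defs.gact1.
  by rewrite ab0.
(* The extra head 0 guarantees n >= 1 when s is empty. *)
have Eg g : \sum_(i < (size s).+1) (nth 0 (0 :: s) i).1 *
    alpha g (nth 0 (0 :: s) i).2 = if g == 1%g then r else 0.
  rewrite -(stensorE alpha) -/(skew_inR alpha r) Es tw_sumE.
  by rewrite big_ord_recl /= mul0r add0r [RHS](big_nth 0) big_mkord.
exists (size s).+1, (fun i => (nth 0 (0 :: s) i).1),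
  (fun i => (nth 0 (0 :: s) i).2); split=> // [g /negbTE ng|].
  by rewrite Eg ng.
have := Eg 1%g; rewrite eqxx => {1}<-.
by apply: eq_bigr => i _; rewrite Defs.gact1.
Qed.

End IdealOfE.

Theorem proposition2p4 (k : fieldType) (gT : finGroupType) (R : algType k)
    (alpha : galgAction gT R)
    (ntG : (1 < #|gT|)%N)
    (charG : forall p : nat, p \in [pchar k] -> ~~ (p %| #|gT|)%N) :
  gradical alpha = bigcap_rann (rmod_killed_by_e alpha).
Proof.
have ntk : (#|gT|%:R : k) != 0.
  (* If the positive integer |G| vanished in [k], the characteristic would be a prime dividing
     it. *)
  apply/negP => nt0; have [p pk] := natf0_pchar (ltnW ntG) nt0.
  by have := charG p pk; rewrite (dvdn_pcharf pk) nt0.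
apply/seteqP; split=> [r /gradicalP[s Es] _ [M Me ->] m|r rP].
  by rewrite rscale_rrestrict [GRing.RMorphism.sort _ _]Es; apply: tw_sum_kills.
(* For this inclusion the single module B / B e B of the class is enough. *)
apply/gradicalP/skew_mod_e_ann => m.
apply: (rP (rrestrict (@skew_inR k gT R alpha) (skew_mod_e alpha))).
by exists (skew_mod_e alpha) => //; exact: skew_mod_e_killed.
Qed.
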